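(* Set $\theta_C(x)=\inf_{c\in C}\big(f(x+c)-f(c)\big)$ for $x\in\mathbb{R}^J$, so $\theta_C\colon\mathbb{R}^J\to\,]-\infty,+\infty]$. Then $\theta_C$ is proper and lower semicontinuous, $$\theta_C=f\,\Box\,\big(-f^\vee+\iota_{-C}\big),$$ where this infimal convolution is exact at every point in $\operatorname{dom}\theta_C=\operatorname{dom}f-C$, and $$\theta_C^*=\overleftarrow{F}_C\circ\nabla f^*.$$ Moreover, $\theta_C$ is convex if and only if $C$ is a singleton.
   Context: $\mathbb{R}^J$ is the standard Euclidean space with inner product $\langle\cdot,\cdot\rangle$ and norm $\|\cdot\|$. Standing assumptions: (1) $f\colon\mathbb{R}^J\to\,]-\infty,+\infty]$ is a convex function of Legendre type, i.e., $f$ is proper, lower semicontinuous, convex, essentially smooth (with $U:=\operatorname{int}\operatorname{dom} f\neq\varnothing$, $f$ is differentiable on $U$ and $\|\nabla f(x_n)\|\to+\infty$ whenever $(x_n)$ is a sequence in $U$ converging to a boundary point of $U$) and essentially strictly convex ($f$ is strictly convex on every convex subset of $\operatorname{dom}\partial f$). (2) $f$ is $1$-coercive: $\lim_{\|x\|\to+\infty} f(x)/\|x\|=+\infty$ (equivalently, $\operatorname{dom} f^*=\mathbb{R}^J$). (3) $C$ is a nonempty bounded closed (hence compact) subset of $U$. A superscript $*$ on a function denotes the Fenchel conjugate; under these assumptions $\nabla f\colon U\to\mathbb{R}^J$ and $\nabla f^*\colon\mathbb{R}^J\to U$ are continuous bijections, inverse to each other. The Bregman distance is $D(x,y)=f(x)-f(y)-\langle\nabla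 f(y),x-y\rangle$ if $y\in U$, and $D(x,y)=+\infty$ otherwise. For $y\in U$, $\overleftarrow{F}_C(y)=\sup_{x\in C}D(x,y)$. The function $-f^\vee+\iota_{-C}$ takes the value $-f(-x)$ if $x\in -C$ and $+\infty$ otherwise. The infimal convolution is $(g\,\Box\,h)(x)=\inf_{y\in\mathbb{R}^J}\big(g(x-y)+h(y)\big)$; it is exact at $x$ if the infimum is attained. *)

(* Defs.v *)
From HB Require Import structures.
From mathcomp Require Export all_boot all_order all_algebra.
From mathcomp Require Export all_classical all_reals all_analysis.
Export numFieldNormedType.Exports.
Export Order.TTheory GRing.Theory Num.Theory.

Set Implicit Arguments.
Unset Strict Implicit.
Unset Printing Implicit Defensive.

Local Open Scope classical_set_scope.
Local Open Scope ring_scope.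

(* The library norm of ['rV[R]_J] is the sup norm, so the Euclidean inner
   product and norm are defined here; the topology is the usual one. *)
Definition dotp (R : realType) (J : nat) (x y : 'rV[R]_J) : R :=
  \sum_(i < J) x 0 i * y 0 i.

Definition enorm (R : realType) (J : nat) (x : 'rV[R]_J) : R :=
  Num.sqrt (dotp x x).

Definition boundary (T : topologicalType) (A : set T) : set T :=
  closure A `\` A^°.

Section ExtendedValuedFunctions.
Variables (R : realType) (J : nat).
Local Notation E := 'rV[R]_J.
Implicit Types (f g h : E -> \bar R) (A C : set E) (x y u : E).

Definition edom f : set E := [set x | (f x < +oo)%E].

Definition eproper f : Prop :=
  (forall x, (-oo < f x)%E) /\ edom f !=set0.

(* Only used for functions that never take the value [-oo], so that no sum
   [-oo + +oo] arises. *)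
Definition convex_efun f : Prop :=
  forall x y (t : R), 0 < t < 1 ->
    (f (t *: x + (1 - t) *: y)%R <= t%:E * f x + (1 - t)%R%:E * f y)%E.

Definition strictly_convex_on A f : Prop :=
  forall x y (t : R), A x -> A y -> x != y -> 0 < t < 1 ->
    (f (t *: x + (1 - t) *: y)%R < t%:E * f x + (1 - t)%R%:E * f y)%E.

Definition subdifferential f x : set E :=
  [set u | forall y, (f x + (dotp u (y - x)%R)%:E <= f y)%E].

Definition dom_subdifferential f : set E :=
  [set x | subdifferential f x !=set0].

(* Differentiability and gradient of [f] are those of its real-valued part
   [fine \o f]; they are meaningful at interior points of [edom f], near which
   a proper [f] is finite. *)
Definition rpart f : E -> R^o := fun x => fine (f x).

Definition grad f x : E := \row_(i < J) 'D_(delta_mx 0 i) (rpart f) x.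

Definition essentially_smooth f : Prop :=
  let U := (edom f)^° in
  [/\ U !=set0,
      forall x, U x -> differentiable (rpart f) x
    & forall (v : nat -> E) x, (forall n, U (v n)) -> boundary U x ->
        v n @[n --> \oo] --> x ->
        enorm (grad f (v n)) @[n --> \oo] --> +oo].

Definition essentially_strictly_convex f : Prop :=
  forall A : set (convex_lmodType E), convex_set A ->
    A `<=` dom_subdifferential f -> strictly_convex_on A f.

Definition convex_legendre f : Prop :=
  [/\ eproper f, lower_semicontinuous f, convex_efun f,
      essentially_smooth f & essentially_strictly_convex f].

Definition one_coercive f : Prop :=
  forall M : R, exists2 r : R, 0 < r & forall x, r < enorm x ->
    (M%:E < f x / (enorm x)%:E)%E.

Definition ebounded A : Prop := exists M : R, forall x, A x -> enorm x <= M.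

Definition conjugate f u : \bar R :=
  ereal_sup (range (fun x => ((dotp u x)%:E - f x)%E)).

Definition infconv g h x : \bar R :=
  ereal_inf (range (fun y => (g (x - y)%R + h y)%E)).

Definition infconv_exact g h x : Prop :=
  exists y, infconv g h x = (g (x - y)%R + h y)%E.

Definition bregman f x y : \bar R :=
  if y \in ((edom f)^° : set E) then (f x - f y - (dotp (grad f y) (x - y)%R)%:E)%E
  else +oo%E.

Definition bregman_sup f C y : \bar R :=
  ereal_sup [set bregman f x y | x in C].

(* The function $-f^\vee+\iota_{-C}$. *)
Definition neg_reflection f C x : \bar R :=
  if x \in [set - c | c in C] then (- f (- x)%R)%E else +oo%E.

Definition theta f C x : \bar R :=
  ereal_inf [set (f (x + c)%R - f c)%E | c in C].

End ExtendedValuedFunctions.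

(* Main.v *)
(* For every slope u, coercivity and lower semicontinuity make f - <u, .>
   attain its minimum at some y; essential smoothness puts y in the interior of
   the domain, so grad f y = u, and strict convexity makes y unique, so that
   compactness yields grad f* u = y.  Substituting x + c in the conjugate of
   theta then gives f*(u) - <u, c> + f c, which is D(c, y).  If theta is convex,
   then theta 0 = 0 and x |-> f (x + c) - f c majorizes theta for every c in C,
   with equality at 0; hence all the gradients of f on C coincide and C is a
   singleton. *)
Require Import Defs.
From mathcomp Require Import lra.
Set Implicit Arguments.
Unset Strict Implicit.
Unset Printing Implicit Defensive.
Local Open Scope classical_set_scope.
Local Open Scope ring_scope.

(** * Extended-real values and lower semicontinuity along filters *)

Lemma lte_real_between (R : realType) (x y : \bar R) :
  (x < y)%E -> exists b : R, (x < b%:E < y)%E.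
Proof.
case: x y => [r| |] [s| |] //= xy.
- exists ((r + s) / 2); rewrite !lte_fin; rewrite lte_fin in xy.
  by apply/andP; split; lra.
- by exists (r + 1); rewrite lte_fin ltry ltrDl ltr01.
- by exists (s - 1); rewrite lte_fin ltNyr gtrDl ltrN10.
- by exists 0; rewrite ltry ltNyr.
Qed.

(* If no minimum is attained, then near each point of [K] the values of [g]
   eventually exceed [g z] as [z] runs along the filter of sublevel sets. *)
Lemma compact_lsc_min (R : realType) (T : topologicalType) (K : set T)
    (g : T -> \bar R) :
  compact K -> K !=set0 ->
  (forall x, K x -> forall a : R, (a%:E < g x)%E ->
    \forall y \near x, (a%:E < g y)%E) ->
  exists2 c, K c & forall z, K z -> (g c <= g z)%E.
Proof.
move=> /compact_near_coveringP cK [z0 Kz0] glsc; apply: contrapT => nomin.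
have below x : K x -> exists2 c, K c & (g c < g x)%E.
  move=> Kx; apply: contrapT => H; apply: nomin; exists x => // z Kz.
  by rewrite leNgt; apply/negP => zx; apply: H; exists z.
pose B c := [set z | K z /\ (g z <= g c)%E].
have FF : Filter (filter_from K B).
  apply: filter_from_filter; first by exists z0.
  move=> i j Ki Kj; have [ij|/ltW ji] := leP (g i) (g j).
    by exists i => // z [Kz zi]; split; split => //; exact: le_trans ij.
  by exists j => // z [Kz zi]; split; split => //; exact: le_trans ji.
have [x Kx] : filter_from K B (fun z => K `<=` [set x | (g z < g x)%E]).
  apply: (cK _ _ (fun z x => (g z < g x)%E) FF) => x Kx.
  have [c Kc /lte_real_between[b /andP[cb bx]]] := below x Kx.
  exists ([set y | (b%:E < g y)%E], B c); first by split; [exact: glsc|exists c].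
  move=> [y z] /= [by_ [Kz zc]].
  exact: le_lt_trans zc (lt_trans cb by_).
by move=> /(_ x (conj Kx (lexx _)) x Kx) /=; rewrite ltxx.
Qed.

(** A real level [b] between [a + r] and [f x] does it: eventually [f (p t)] exceeds [b] and [q t]
    stays below [b - a]. An arbitrary filter allows use on product neighbourhoods. *)
Lemma lsc_cvg_sub (R : realType) (X : topologicalType) (f : X -> \bar R)
    (T : Type) (F : set_system T) (p : T -> X) (q : T -> R) (x : X) (r a : R) :
  Filter F -> lower_semicontinuous f -> p @ F --> x -> q @ F --> r ->
  (a%:E < f x - r%:E)%E -> \forall t \near F, (a%:E < f (p t) - (q t)%:E)%E.
Proof.
move=> FF flsc px qr; rewrite lteBrDr// -EFinD.
move=> /lte_real_between[b /andP[]]; rewrite lte_fin => arb bx.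
have [V Vx Vb] := flsc _ _ bx.
near=> t.
have : (b%:E < f (p t))%E by apply: Vb; near: t; exact: px.
have : q t < b - a.
  by near: t; apply: (cvgr_lt r) => //; rewrite ltrBrDr addrC.
move=> qt bf; rewrite lteBrDr// -EFinD; apply: lt_trans bf.
by rewrite lte_fin; lra.
Unshelve. all: by end_near. Qed.

(** * Euclidean inner product, norms and directional derivatives *)

Section Euclidean.
Variables (R : realType) (J : nat).
Local Notation E := 'rV[R]_J.
Implicit Types (x y u v : E) (a b : R).

Lemma dotpDr u x y : dotp u (x + y) = dotp u x + dotp u y.
Proof. by rewrite /dotp -big_split; apply: eq_bigr => i _; rewrite mxE mulrDr. Qed.

Lemma dotpZr u a x : dotp u (a *: x) = a * dotp u x.
Proof. by rewrite /dotp mulr_sumr; apply: eq_bigr => i _; rewrite mxE mulrCA. Qed.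

Lemma dotpC u x : dotp u x = dotp x u.
Proof. by apply: eq_bigr => i _; rewrite mulrC. Qed.

Lemma dotpNr u x : dotp u (- x) = - dotp u x.
Proof. by rewrite -scaleN1r dotpZr mulN1r. Qed.

Lemma dotpBr u x y : dotp u (x - y) = dotp u x - dotp u y.
Proof. by rewrite dotpDr dotpNr. Qed.

Lemma dotpDl u v x : dotp (u + v) x = dotp u x + dotp v x.
Proof. by rewrite dotpC dotpDr !(dotpC x). Qed.

Lemma dotpZl u a x : dotp (a *: u) x = a * dotp u x.
Proof. by rewrite dotpC dotpZr dotpC. Qed.

Lemma dotp_delta u i : dotp u (delta_mx 0 i) = u 0 i.
Proof.
rewrite /dotp (bigD1 i)//= mxE !eqxx mulr1 big1 ?addr0// => j ji.
by rewrite mxE (negbTE ji) andbF mulr0.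
Qed.

Lemma dotp_le_eq u v : (forall x, dotp u x <= dotp v x) -> u = v.
Proof.
move=> uv; apply/rowP => i; apply/eqP; rewrite eq_le -!dotp_delta uv/=.
by rewrite -lerN2 -!dotpNr uv.
Qed.

Lemma dotp_continuous (T : Type) (F : set_system T) (p q : T -> E) x y :
  Filter F -> p @ F --> x -> q @ F --> y ->
  dotp (p t) (q t) @[t --> F] --> dotp x y.
Proof.
move=> FF px qy; apply: cvg_big => [|i _].
  by move=> [a b]; apply: cvgD; [exact: cvg_fst|exact: cvg_snd].
have coord (z : E) : (fun w : E => w 0 i) @ z --> z 0 i by exact: coord_continuous.
exact: cvgM (cvg_comp _ _ px (coord x)) (cvg_comp _ _ qy (coord y)).
Qed.

Lemma cvg_axpy (T : Type) (F : set_system T) (c : T -> R) (p q : T -> E) a x y :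
  Filter F -> c @ F --> a -> p @ F --> x -> q @ F --> y ->
  c t *: p t + q t @[t --> F] --> a *: x + y.
Proof. by move=> FF ca px qy; exact: (cvgD (cvgZ ca px) qy). Qed.

Lemma cvg_line_right x v : h *: v + x @[h --> 0^'+] --> x.
Proof.
rewrite -[X in _ --> X]add0r -(scale0r v).
apply: cvg_axpy; [exact: cvg_at_right_filter cvg_id|exact: cvg_cst|exact: cvg_cst].
Qed.

Lemma coord_le_enorm x i : `|x 0 i| <= enorm x.
Proof.
rewrite -sqrtr_sqr ler_sqrt; last by apply: sumr_ge0 => j _; rewrite -expr2 sqr_ge0.
rewrite /dotp (bigD1 i)//= -expr2 lerDl.
by apply: sumr_ge0 => j _; rewrite -expr2 sqr_ge0.
Qed.

Lemma enorm_ge0 x : 0 <= enorm x. Proof. exact: sqrtr_ge0. Qed.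

Lemma coord_le_norm x i : `|x 0 i| <= `|x|.
Proof.
rewrite [leRHS]/Num.Def.normr /= mx_normrE; apply/bigmax_geP; right => /=.
by exists (0, i).
Qed.

Lemma norm_le_enorm x : `|x| <= enorm x.
Proof.
rewrite [leLHS]/Num.Def.normr /= mx_normrE; apply/bigmax_leP; split => [|[k i] _ /=].
  exact: enorm_ge0.
by rewrite (ord1 k) coord_le_enorm.
Qed.

(** A crude substitute for Cauchy-Schwarz with the sup norm of [u]; it serves to bound [dotp u x]
    uniformly for [u] in a ball. *)
Lemma dotp_le_norm u x a : (forall i, `|x 0 i| <= a) ->
  dotp u x <= J%:R * `|u| * a.
Proof.
move=> xa; apply: (@le_trans _ _ (\sum_(i < J) `|u| * a)); last first.
  by rewrite sumr_const card_ord -mulrA mulr_natl.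
apply: ler_sum => i _; apply: le_trans (ler_norm _) _; rewrite normrM.
by apply: ler_pM => //; exact: coord_le_norm.
Qed.

Lemma ebounded_bounded (A : set E) : ebounded A -> bounded_set A.
Proof.
move=> [M AM]; exists M; split; first exact: num_real.
move=> N MN x Ax; exact: le_trans (norm_le_enorm x) (le_trans (AM _ Ax) (ltW MN)).
Qed.

Lemma compact_norm_le a : compact [set x : E | `|x| <= a].
Proof.
apply: bounded_closed_compact.
  exists a; split; first exact: num_real.
  by move=> N aN x /= xa; exact: le_trans xa (ltW aN).
by have /continuous_closedP/(_ _ (@closed_le R a)) := @norm_continuous R E.
Qed.

(** Convexity and subgradient inequalities get divided by [h]; quotients with [h > 0] keep their
    direction. *)
Lemma derive_right (F : E -> R^o) x v : derivable F x v ->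
  h^-1 * (F (h *: v + x) - F x) @[h --> 0^'+] --> 'D_v F x.
Proof. by move=> dF; apply: cvg_dnbhs_at_right. Qed.

Lemma derive_dotp (f : E -> \bar R) x v : differentiable (rpart f) x ->
  'D_v (rpart f) x = dotp (grad f x) v.
Proof.
move=> df; rewrite deriveE// {1}(row_sum_delta v) linear_sum; apply: eq_bigr => i _.
by rewrite linearZ mxE deriveE// mulrC.
Qed.

End Euclidean.

(** * Convex functions: subgradients, gradients and steepness *)

Section ConvexFunctions.
Variables (R : realType) (J : nat) (f : 'rV[R]_J -> \bar R).
Local Notation E := 'rV[R]_J.
Local Notation U := ((edom f)°).
Hypothesis f_proper : eproper f.
Implicit Types (x y u v a : E) (t : R).

Lemma rpartK x : edom f x -> f x = (rpart f x)%:E.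
Proof.
by move=> xdom; rewrite fineK// fin_real// (proj1 f_proper)//; apply: xdom.
Qed.

(** Were [f x = +oo], the subgradient inequality would force [f = +oo] everywhere, against
    properness. *)
Lemma subdifferential_edom x u : subdifferential f x u -> edom f x.
Proof.
move=> ux; have [_ [z zdom]] := f_proper; rewrite /edom/= ltNge leye_eq.
apply/negP => /eqP fx; have := ux z; rewrite fx addye// leye_eq => /eqP fz.
by have := zdom; rewrite /edom/= fz ltxx.
Qed.

Lemma subdifferentialP x u : edom f x ->
  subdifferential f x u <->
  forall y, edom f y -> rpart f x + dotp u (y - x) <= rpart f y.
Proof.
move=> xdom; split=> [ux y ydom|ux y].
  by have := ux y; rewrite !rpartK// -EFinD lee_fin.
have [ydom|] := pselect (edom f y); first by rewrite !rpartK// -EFinD lee_fin ux.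
by move=> /negP; rewrite -leNgt leye_eq => /eqP ->; exact: leey.
Qed.

(** Equality case of Fenchel-Young: a subgradient [u] at [x] says that [x] maximizes
    [dotp u - f]. *)
Lemma conjugate_subdifferential x u : subdifferential f x u ->
  conjugate f u = (dotp u x - rpart f x)%:E.
Proof.
move=> ux; have xdom := subdifferential_edom ux; apply/eqP; rewrite eq_le.
apply/andP; split; last first.
  by apply: ereal_sup_ubound; exists x => //; rewrite rpartK// EFinB.
apply: ge_ereal_sup => _ [y _ <-]; have [ydom|] := pselect (edom f y).
  have := (subdifferentialP _ xdom).1 ux y ydom.
  rewrite rpartK// -EFinB lee_fin dotpBr; lra.
move=> /negP; rewrite -leNgt leye_eq => /eqP ->; exact: leNye.
Qed.

Hypothesis f_convex : convex_efun f.

Lemma edom_convex x y t : 0 < t < 1 -> edom f x -> edom f y ->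
  edom f (t *: x + (1 - t) *: y).
Proof.
move=> t01 xdom ydom; apply: le_lt_trans (f_convex x y t01) _.
by rewrite !rpartK// -!EFinM -EFinD ltry.
Qed.

Lemma rpart_convex x y t : 0 < t < 1 -> edom f x -> edom f y ->
  rpart f (t *: x + (1 - t) *: y) <= t * rpart f x + (1 - t) * rpart f y.
Proof.
move=> t01 xdom ydom; have := f_convex x y t01.
rewrite (rpartK xdom) (rpartK ydom) (rpartK (edom_convex t01 xdom ydom)).
by rewrite -!EFinM -EFinD lee_fin.
Qed.

(** The homothety of centre [x] and ratio [t] carries a neighbourhood of [a] in the domain onto one
    of [p], which convexity keeps in the domain; [h] is its inverse. *)
Lemma interior_edom_segment a x t : 0 < t < 1 -> U a -> edom f x ->
  U (t *: a + (1 - t) *: x).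
Proof.
move=> t01 Ua xdom; pose p := t *: a + (1 - t) *: x; pose h y := t^-1 *: (y - p) + a.
have t0 : t != 0 by case/andP: t01 => /lt0r_neq0.
have hp : h @ p --> a.
  have : h @ p --> h p.
    apply: (@cvg_axpy R J E (nbhs p) (fun=> t^-1) (fun y => y - p) (fun=> a)).
    - exact: cvg_cst.
    - exact: (@cvgB _ _ _ (nbhs p) _ _ _ _ _ cvg_id (cvg_cst _)).
    - exact: cvg_cst.
  by rewrite /h subrr scaler0 add0r.
apply: (@filterS _ (nbhs p) _ _ _ _ (hp _ Ua)) => y hy.
suff -> : y = t *: h y + (1 - t) *: x by exact: edom_convex.
by rewrite /h scalerDr scalerA divff// scale1r -addrA -/p subrK.
Qed.

Lemma interior_edom x : U x -> edom f x.
Proof. exact: interior_subset. Qed.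

Hypothesis f_diff : forall x, U x -> differentiable (rpart f) x.

(** By convexity, the quotient of [f] at [x] along [y - x] is at most [f y - f x] for [0 < h < 1];
    then [h] tends to 0. *)
Lemma gradient_inequality x y : U x -> edom f y ->
  rpart f x + dotp (grad f x) (y - x) <= rpart f y.
Proof.
move=> Ux ydom; have xdom := interior_edom Ux.
have dv := f_diff Ux; rewrite -lerBrDl -derive_dotp//.
have dr := derive_right (@diff_derivable _ _ _ _ _ (y - x) dv).
rewrite -(cvg_lim _ dr)//; apply: limr_le; first by apply/cvg_ex; eexists; exact: dr.
near=> h; have h0 : 0 < h by near: h; exact: nbhs_right_gt.
have h1 : h < 1 by near: h; exact: nbhs_right_lt.
rewrite ler_pdivrMl//.
have -> : h *: (y - x) + x = h *: y + (1 - h) *: x.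
  by rewrite scalerBr scalerBl scale1r addrAC addrA.
have h01 : 0 < h < 1 by rewrite h0.
by have := rpart_convex h01 ydom xdom; lra.
Unshelve. all: by end_near. Qed.

Lemma grad_subdifferential x : U x -> subdifferential f x (grad f x).
Proof.
move=> Ux; apply/subdifferentialP; first exact: interior_edom.
by move=> y; exact: gradient_inequality.
Qed.

(** Right-hand quotients at [x] along any [v] are at least [dotp u v], so
    [dotp u <= dotp (grad f x)] everywhere, and linear forms so ordered are equal. *)
Lemma subdifferential_grad x u : U x -> subdifferential f x u -> grad f x = u.
Proof.
move=> Ux; have xdom := interior_edom Ux; move=> /(subdifferentialP _ xdom) ux.
apply/esym; apply: dotp_le_eq => v; rewrite -derive_dotp; last exact: f_diff.
have dr := derive_right (@diff_derivable _ _ _ _ _ v (f_diff Ux)).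
rewrite -(cvg_lim _ dr)//; apply: limr_ge; first by apply/cvg_ex; eexists; exact: dr.
near=> h; have h0 : 0 < h by near: h; exact: nbhs_right_gt.
rewrite ler_pdivlMl// lerBrDl -dotpZr -[in dotp _ _](addrK x (h *: v)).
by apply: ux; near: h; exact: (@cvg_line_right _ _ x v _ Ux).
Unshelve. all: by end_near. Qed.

(* At a boundary point [x], the gradients along a segment from [a] in the interior
   to [x] are bounded in every direction: monotonicity bounds their slopes along
   [a - x] from below by [dotp u (a - x)], and finiteness of [f] around [a] then
   bounds the others.  This contradicts steepness. *)
Lemma subdifferential_sub_interior x u :
  U !=set0 ->
  (forall (v : nat -> E) x, (forall n, U (v n)) -> boundary U x ->
    v n @[n --> \oo] --> x -> enorm (grad f (v n)) @[n --> \oo] --> +oo) ->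
  subdifferential f x u -> U x.
Proof.
move=> [a Ua] steep ux; have xdom := subdifferential_edom ux.
apply: contrapT => nUx.
(* Starting at 1/2 keeps [t n < 1] for every [n], so that each [w n] is interior. *)
pose t n : R := n.+2%:R^-1.
have t01 n : 0 < t n < 1 by rewrite invr_gt0 ltr0n invf_lt1 ?ltr0n// ltr1n.
pose w n := t n *: a + (1 - t n) *: x.
have Uw n : U (w n) by exact: interior_edom_segment.
have wx : w n @[n --> \oo] --> x.
  have t0 : t n @[n --> \oo] --> 0.
    by have := @cvg_harmonic R; rewrite -(@cvg_shiftS R^o).
  have : w n @[n --> \oo] --> 0 *: a + (1 - 0) *: x.
    apply: (@cvg_axpy R J nat \oo t (fun=> a) (fun n => (1 - t n) *: x)) => //.
      exact: cvg_cst.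
    apply: (@cvgZ R E nat \oo _ (fun n => 1 - t n) (fun=> x)); last exact: cvg_cst.
    exact: (@cvgB R R^o nat \oo _ (fun=> 1) t _ _ (cvg_cst _) t0).
  by rewrite scale0r add0r subr0 scale1r.
have bx : boundary U x.
  split; last by move=> /interior_subset.
  move=> B Bx; near \oo => n; exists (w n); split; first exact: Uw.
  by near: n; exact: wx.
have ray v : exists M, forall n, dotp (grad f (w n)) v <= M.
  near (0 : R)^'+ => r.
  have r0 : 0 < r by near: r; exact: nbhs_right_gt.
  have rdom : edom f (r *: v + a) by near: r; exact: (@cvg_line_right _ _ a v _ Ua).
  pose c := dotp u (a - x).
  (* The inequalities between [w n] and [x] give slope at least [c] along [a - x] and
     [f (w n) >= f x + t n * c]. The gradient inequality at [r *: v + a] then bounds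
     [r * dotp (grad f (w n)) v] by [f (r *: v + a) - f x - c]. *)
  exists (r^-1 * (rpart f (r *: v + a) - rpart f x + 2 * `|c|)) => n.
  rewrite ler_pdivlMl//.
  have Wx : w n - x = t n *: (a - x).
    by rewrite /w scalerBl scale1r addrA addrAC addrK scalerBr.
  have wdom := interior_edom (Uw n).
  have := (subdifferentialP _ xdom).1 ux _ wdom.
  have := gradient_inequality (Uw n) xdom.
  have := gradient_inequality (Uw n) rdom.
  have -> : r *: v + a - w n = r *: v + (1 - t n) *: (a - x).
    by rewrite -addrA; congr (_ + _); rewrite scalerBl scale1r -Wx opprB addrA subrK.
  have -> : x - w n = - (t n *: (a - x)) by rewrite -Wx opprB.
  rewrite Wx dotpNr dotpDr !dotpZr -/c.
  set g := dotp _ (a - x); set gv := dotp _ v; case/andP: (t01 n) => tn0 tn1 h1 h2 h3.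
  have cg : c <= g by rewrite -(ler_pM2l tn0); lra.
  have cn : - `|c| <= c by rewrite lerNl ler_normr lexx orbT.
  by have := normr_ge0 c; nra.
have [M gM] := choice ray.
(* Rays along plus and minus each basis vector bound the partial derivatives on both sides, hence
   the Euclidean norm, independently of [n]. *)
pose K i := `|M (delta_mx 0 i)| + `|M (- delta_mx 0 i)|.
have /cvgryPge/(_ (Num.sqrt (\sum_i K i ^+ 2) + 1)) := steep w x Uw bx wx.
move=> big; near \oo => n.
have : Num.sqrt (\sum_i K i ^+ 2) + 1 <= enorm (grad f (w n)) by near: n.
apply/negP; rewrite -ltNge; apply: le_lt_trans (_ : _ <= Num.sqrt (\sum_i K i ^+ 2)) _.
  rewrite ler_sqrt; last by apply: sumr_ge0 => i _; exact: sqr_ge0.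
  apply: ler_sum => i _; rewrite -expr2 -(real_normK (num_real (grad _ _ _ _))).
  rewrite ler_sqr ?nnegrE ?addr_ge0// ler_norml; apply/andP; split.
    rewrite lerNl -dotp_delta -dotpNr; apply: le_trans (gM _ _) _.
    by apply: le_trans (ler_norm _) _; rewrite lerDr.
  rewrite -dotp_delta; apply: le_trans (gM _ _) _.
  by apply: le_trans (ler_norm _) _; rewrite lerDl.
by rewrite ltrDl.
Unshelve. all: by end_near. Qed.

End ConvexFunctions.

(** * Legendre functions: points with a given slope and the gradient of the conjugate *)

Section Legendre.
Variables (R : realType) (J : nat) (f : 'rV[R]_J -> \bar R).
Local Notation E := 'rV[R]_J.
Local Notation U := ((edom f)°).
Hypothesis f_legendre : convex_legendre f.
Implicit Types (x y z u v : E).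

Let f_proper : eproper f. Proof. by case: f_legendre. Qed.
Let f_lsc : lower_semicontinuous f. Proof. by case: f_legendre. Qed.
Let f_convex : convex_efun f. Proof. by case: f_legendre. Qed.
Let f_diff x : U x -> differentiable (rpart f) x.
Proof. by case: f_legendre => _ _ _ [_ + _] _; exact. Qed.

Lemma legendre_subdifferential_interior x u : subdifferential f x u -> U x.
Proof.
have [_ _ _ [U0 _ steep] _] := f_legendre.
exact: (subdifferential_sub_interior f_proper f_convex f_diff U0 steep).
Qed.

(** Both points lie in the interior, a convex set on which [f] is strictly convex; their midpoint
    would undercut the common minimum of [f - dotp u]. *)
Lemma legendre_subdifferential_inj x y u :
  subdifferential f x u -> subdifferential f y u -> x = y.
Proof.
move=> ux uy; apply/eqP; apply/negPn/negP => xy.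
have Ux := legendre_subdifferential_interior ux.
have Uy := legendre_subdifferential_interior uy.
have Uconv : convex_set (U : set (convex_lmodType E)).
  apply/convex_setW => a b; rewrite !inE => Ua Ub k k0 k1; rewrite inE.
  apply: (interior_edom_segment f_proper f_convex _ Ua (interior_edom Ub)).
  by rewrite k0.
have Usub : U `<=` dom_subdifferential f.
  by move=> a Ua; exists (grad f a); exact: grad_subdifferential.
have [_ _ _ _ /(_ _ Uconv Usub x y 2^-1 Ux Uy xy)] := f_legendre.
have h01 : 0 < (2^-1 : R) < 1 by apply/andP; split; lra.
have [xdom ydom] := (interior_edom Ux, interior_edom Uy).
move=> /(_ h01); set m := _ + _; have mdom : edom f m by exact: edom_convex.
have := (subdifferentialP f_proper _ ydom).1 uy m mdom.
have := (subdifferentialP f_proper _ xdom).1 ux m mdom.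
rewrite !rpartK// -!EFinM -EFinD lte_fin !dotpBr !dotpDr !dotpZr; lra.
Qed.

Hypothesis f_coercive : one_coercive f.

(** Beyond the coercivity radius, [f x] exceeds [(J%:R * B + 1) * enorm x] while [dotp u x] is at
    most [J%:R * B * enorm x], which leaves [enorm x < a]. Uniformity in [u] keeps minimizers in one
    ball while the slope moves. *)
Lemma coercive_bound (B a : R) : exists r, forall u x, `|u| <= B ->
  edom f x -> rpart f x - dotp u x <= a -> `|x| <= r.
Proof.
have [r r0 rP] := f_coercive (J%:R * B + 1).
exists (Num.max r a) => u x uB xdom xa; apply: le_trans (norm_le_enorm x) _.
rewrite le_max; have [//|rx] := leP (enorm x) r; apply/orP; right.
have := rP x rx; have x0 : 0 < enorm x by exact: lt_trans rx.
rewrite rpartK// inver gt_eqF// -EFinM lte_fin ltr_pdivlMr// => fx.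
have ux : dotp u x <= J%:R * B * enorm x.
  apply: le_trans (dotp_le_norm u (coord_le_enorm x)) _.
  by rewrite ler_wpM2r ?enorm_ge0// ler_wpM2l.
lra.
Qed.

(** A compact ball contains the sublevel set of [f - dotp u] at the level of a domain point [z], so
    a minimum over the ball is global. *)
Lemma exists_subdifferential u : exists y, subdifferential f y u.
Proof.
have [_ [z zdom]] := f_proper.
have [r rP] := coercive_bound `|u| (rpart f z - dotp u z).
pose g x := (f x - (dotp u x)%:E)%E.
have zr : `|z| <= r by exact: rP zdom (lexx _).
have glsc x (a : R) : (a%:E < g x)%E -> \forall x' \near x, (a%:E < g x')%E.
  apply: (@lsc_cvg_sub R E f E (nbhs x) id (dotp u)) => //.
  exact: (@dotp_continuous R J E (nbhs x) (fun=> u) id u x _ (cvg_cst _)).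
have [y /= yr ymin] := compact_lsc_min (@compact_norm_le R J r)
  (ex_intro _ z zr) (fun x _ => glsc x).
have ydom : edom f y.
  rewrite /edom/= ltNge leye_eq; apply/negP => /eqP fy.
  have := ymin z zr; rewrite /g fy rpartK// addye// leye_eq -EFinB => /eqP.
exists y; apply/subdifferentialP => // x xdom; rewrite dotpBr.
have gE w : edom f w -> g w = (rpart f w - dotp u w)%:E by move=> wd; rewrite /g rpartK.
have [xr|xr] := leP `|x| r.
  by have := ymin x xr; rewrite !gE// lee_fin; lra.
have := ymin z zr; rewrite !gE// lee_fin.
have : rpart f z - dotp u z < rpart f x - dotp u x.
  by rewrite ltNge; apply/negP => /(rP u x (lexx _) xdom); rewrite leNgt xr.
lra.
Qed.

(** By uniqueness, [f - dotp u] exceeds its minimum strictly on the compact set [K] of points of a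
    fixed ball away from [y]. By compactness this survives a small tilt [h *: e], so no minimizer of
    the tilted function lies in [K]. *)
Lemma subdifferential_near (y u e : E) (eps : R) : 0 < eps ->
  subdifferential f y u ->
  \forall h \near (0 : R), forall z, subdifferential f z (u + h *: e) ->
    `|z - y| < eps.
Proof.
move=> eps0 uy; have ydom := subdifferential_edom f_proper uy.
(* For [|h| <= 1], the tilted slope has norm at most [|u| + |e|], and the tilt moves the level at
   [y] by at most [|dotp e y|]. *)
have [r rP] := coercive_bound (`|u| + `|e|) (rpart f y - dotp u y + `|dotp e y|).
pose K : set E := [set z | `|z| <= r] `&` ~` ball y eps.
have cK : compact K.
  apply: compact_closedI; first exact: compact_norm_le.
  by apply: open_closedC; exact: ball_open.
pose P (h : R) z := ((rpart f y)%:E < f z - (dotp (u + h *: e) (z - y))%:E)%E.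
have Kfar : \forall h \near (0 : R), K `<=` P h.
  apply: ((compact_near_coveringP K).1 cK R (nbhs (0 : R)) P _) => z [_ zy].
  have fz : ((rpart f y)%:E < f z - (dotp u (z - y))%:E)%E.
    have [zdom|] := pselect (edom f z); last first.
      by move=> /negP; rewrite -leNgt leye_eq => /eqP ->; rewrite addye// ltry.
    rewrite rpartK// -EFinB lte_fin ltNge; apply/negP => zmin; apply: zy.
    suff -> : z = y by exact: ballxx.
    apply: (legendre_subdifferential_inj (u := u)) => //.
    apply/subdifferentialP => // w wdom.
    have := (subdifferentialP f_proper _ ydom).1 uy w wdom.
    by move: zmin; rewrite !dotpBr; lra.
  have near_fz (T : Type) (F : set_system T) (p : T -> E) (h : T -> R) :
      Filter F -> p @ F --> z -> h @ F --> 0 ->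
      \forall t \near F,
        ((rpart f y)%:E < f (p t) - (dotp (u + h t *: e) (p t - y))%:E)%E.
    move=> FF pz h0.
    apply: (@lsc_cvg_sub R E f T F p (fun t => dotp (u + h t *: e) (p t - y)) z
      (dotp u (z - y))) => //.
    apply: dotp_continuous; last exact: (cvgB pz (cvg_cst _)).
    rewrite -[X in _ --> X]addr0 -(scale0r e).
    exact: (cvgD (cvg_cst _) (cvgZ h0 (cvg_cst _))).
  exact: (near_fz _ (filter_prod (nbhs z) (nbhs (0 : R))) fst snd _ cvg_fst cvg_snd).
near=> h => z uz; have zdom := subdifferential_edom f_proper uz.
have h1 : `|h| <= 1 by near: h; apply: (@nbhs0_le R R^o).
have := (subdifferentialP f_proper _ zdom).1 uz y ydom.
rewrite ltNge => zuy; apply/negP => far.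
have : P h z.
  suff : K z by move: z {uz zdom zuy far}; near: h.
  split; last by rewrite -ball_normE /ball_/= distrC; apply/negP; rewrite -leNgt.
  apply: (rP (u + h *: e)) => //.
    apply: le_trans (ler_normD _ _) _; rewrite lerD2l normrZ.
    by rewrite ler_piMl.
  have : - (h * dotp e y) <= `|dotp e y|.
    apply: le_trans (ler_norm _) _; rewrite normrN normrM.
    by rewrite ler_piMl.
  by move: zuy; rewrite !dotpBr !dotpDl !dotpZl; lra.
rewrite /P rpartK// -EFinB lte_fin.
by move: zuy; rewrite !dotpBr; lra.
Unshelve. all: by end_near. Qed.

(** If [z] has slope [u + h *: e], the two subgradient inequalities squeeze the increment [Q] of the
    conjugate between [h * y 0 i] and [h * z 0 i], and [z] tends to [y] with [h]. *)
Lemma grad_conjugate u y : subdifferential f y u -> grad (conjugate f) u = y.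
Proof.
move=> uy; have ydom := subdifferential_edom f_proper uy.
apply/rowP => i; rewrite mxE; set e := delta_mx 0 i.
have conjE v z : subdifferential f z v ->
    rpart (conjugate f) v = dotp v z - rpart f z.
  by move=> vz; rewrite /rpart (conjugate_subdifferential f_proper vz).
apply: cvg_lim => //; apply/cvgrPdist_lt => eps eps0.
near=> h.
have h0 : h != 0 by near: h; exact: nbhs_dnbhs_neq.
have [z hz] := exists_subdifferential (u + h *: e).
have zdom := subdifferential_edom f_proper hz.
have zy : `|z - y| < eps.
  move: z hz {zdom}; near: h; apply: nbhs_dnbhs.
  exact: subdifferential_near.
apply: le_lt_trans zy; apply: le_trans (coord_le_norm (z - y) i).
have := (subdifferentialP f_proper _ ydom).1 uy z zdom.
have := (subdifferentialP f_proper _ zdom).1 hz y ydom.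
rewrite /= [h *: e + u]addrC (conjE _ _ hz) (conjE _ _ uy) /GRing.scale/=.
rewrite !dotpBr !dotpDl !dotpZl ![dotp e _]dotpC !dotp_delta !mxE.
set Q := _ - (dotp u y - _) => hy hz'.
(* Multiplying by [|h|] treats both signs of [h] at once. *)
rewrite -(ler_pM2l (x := `|h|)) ?normr_gt0// -!normrM mulrBr mulVKf//.
have yQ : h * y 0 i <= Q by rewrite /Q; lra.
apply: (le_trans _ (ler_norm _)); rewrite distrC ger0_norm ?subr_ge0// mulrBr /Q.
lra.
Unshelve. all: by end_near. Qed.

End Legendre.

(** * The function [theta]: attainment, infimal convolution, conjugate and convexity *)

Section Theta.
Variables (R : realType) (J : nat) (f : 'rV[R]_J -> \bar R) (C : set 'rV[R]_J).
Local Notation E := 'rV[R]_J.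
Local Notation U := ((edom f)°).
Hypotheses (f_legendre : convex_legendre f) (C_nonempty : C !=set0).
Hypotheses (C_compact : compact C) (C_sub : C `<=` U).
Implicit Types (x y c u v : E).

Let f_proper : eproper f. Proof. by case: f_legendre. Qed.
Let f_lsc : lower_semicontinuous f. Proof. by case: f_legendre. Qed.
Let f_convex : convex_efun f. Proof. by case: f_legendre. Qed.
Let f_diff x : U x -> differentiable (rpart f) x.
Proof. by case: f_legendre => _ _ _ [_ + _] _; exact. Qed.
Let C_dom c : C c -> edom f c.
Proof. by move=> /C_sub; exact: interior_edom. Qed.

(** [f] is continuous at the interior point [c], so subtracting it preserves lower semicontinuity.
    Attainment uses this with [x] fixed, semicontinuity of [theta] with both points moving. *)
Lemma lsc_shift_sub (T : Type) (F : set_system T) (p q : T -> E) x c (a : R) :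
  Filter F -> p @ F --> x -> q @ F --> c -> U c ->
  (a%:E < f (x + c)%R - f c)%E ->
  \forall t \near F, (a%:E < f (p t + q t)%R - f (q t))%E.
Proof.
move=> FF px qc Uc; rewrite (rpartK f_proper (interior_edom Uc)) => axc.
have rqc : rpart f (q t) @[t --> F] --> rpart f c.
  exact: (cvg_comp _ _ qc (differentiable_continuous (f_diff Uc))).
have := lsc_cvg_sub FF f_lsc (cvgD px qc) rqc axc.
move=> near_pq; near=> t.
have qdom : edom f (q t) by near: t; exact: (qc _ Uc).
by rewrite (rpartK f_proper qdom); near: t; exact: near_pq.
Unshelve. all: by end_near. Qed.

Lemma theta_attained x : exists2 c, C c & theta f C x = (f (x + c)%R - f c)%E.
Proof.
have glsc c : C c -> forall a : R, (a%:E < f (x + c)%R - f c)%E ->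
    \forall d \near c, (a%:E < f (x + d)%R - f d)%E.
  move=> Cc a; exact: (@lsc_shift_sub E (nbhs c) (fun=> x) id x c a _
    (cvg_cst _) cvg_id (C_sub Cc)).
have [c Cc cmin] := compact_lsc_min C_compact C_nonempty glsc.
exists c => //; apply/eqP; rewrite eq_le; apply/andP; split.
  by apply: ereal_inf_lbound; exists c.
by apply: le_ereal_inf_tmp => _ [d Cd <-]; exact: cmin.
Qed.

Lemma theta_le x c : C c -> (theta f C x <= f (x + c)%R - f c)%E.
Proof. by move=> Cc; apply: ereal_inf_lbound; exists c. Qed.

Lemma edom_theta : edom (theta f C) = [set u - c | u in edom f & c in C].
Proof.
apply/seteqP; split=> [x|_ [u udom [c Cc <-]]]; rewrite /edom/=.
  have [c Cc ->] := theta_attained x; rewrite (rpartK f_proper (C_dom Cc)) => xdom.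
  exists (x + c); last by exists c => //; rewrite addrK.
  by rewrite /edom/= ltNge leye_eq; apply/negP => /eqP xc; move: xdom; rewrite xc.
apply: le_lt_trans (theta_le _ Cc) _; rewrite subrK !rpartK//; last exact: C_dom.
by rewrite -EFinB ltry.
Qed.

Lemma theta_gtNy x : (-oo < theta f C x)%E.
Proof.
have [c Cc ->] := theta_attained x; rewrite (rpartK f_proper (C_dom Cc)).
have [xdom|] := pselect (edom f (x + c)); first by rewrite rpartK// -EFinB ltNyr.
by move=> /negP; rewrite -leNgt leye_eq => /eqP ->; rewrite addye// ltNyy.
Qed.

(** Compactness of [C] yields a neighbourhood of [x] where the bound holds for all [c] at once;
    attainment keeps it strict for the infimum. *)
Lemma theta_lsc : lower_semicontinuous (theta f C).
Proof.
move=> x a ax; exists [set y | C `<=` [set c | a%:E < f (y + c)%R - f c]%E].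
  apply: ((compact_near_coveringP C).1 C_compact E (nbhs x)
    (fun y c => (a%:E < f (y + c)%R - f c)%E) _) => c Cc.
  apply: (@lsc_shift_sub (E * E) (filter_prod (nbhs c) (nbhs x)) snd fst x c a _
    cvg_snd cvg_fst (C_sub Cc)).
  exact: lt_le_trans ax (theta_le x Cc).
by move=> y ay; have [c Cc ->] := theta_attained y; exact: ay.
Qed.

Lemma neg_reflectionN c : C c -> neg_reflection f C (- c) = (- f c)%E.
Proof.
move=> Cc; rewrite /neg_reflection opprK; case: ifPn => // /negP[].
by rewrite inE; exists c.
Qed.

(** The points [y = - c] reproduce the terms of [theta]; any other [y] contributes [+oo], as [f]
    never takes the value [-oo]. *)
Lemma theta_infconv : theta f C = infconv f (neg_reflection f C).
Proof.
apply/funext => x; apply/eqP; rewrite eq_le; apply/andP; split.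
  apply: le_ereal_inf_tmp => _ [y _ <-].
  have [[c Cc <-]|yC] := pselect ([set - c | c in C] y).
    by rewrite neg_reflectionN// opprK; exact: theta_le.
  rewrite /neg_reflection ifF; first by rewrite addey ?leey// gt_eqF// (proj1 f_proper).
  by apply/negP; rewrite inE.
have [c Cc ->] := theta_attained x; apply: ereal_inf_lbound; exists (- c) => //.
by rewrite neg_reflectionN// opprK.
Qed.

Lemma theta_infconv_exact x : infconv_exact f (neg_reflection f C) x.
Proof.
have [c Cc xc] := theta_attained x; exists (- c).
by rewrite -theta_infconv neg_reflectionN// opprK.
Qed.

(** For the upper bound, the subgradient inequality at [x + c], with [c] attaining [theta] at [x],
    bounds the term of [x] by the Bregman distance from [c] to [y]. *)
Lemma conjugate_theta u y : subdifferential f y u ->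
  conjugate (theta f C) u = bregman_sup f C y.
Proof.
move=> uy; have Uy := legendre_subdifferential_interior f_legendre uy.
have ydom := interior_edom Uy.
have gy : grad f y = u by exact: subdifferential_grad.
have bE c : C c -> bregman f c y = (rpart f c - rpart f y - dotp u (c - y))%:E.
  by move=> Cc; rewrite /bregman gy ifT ?inE// !rpartK//; exact: C_dom.
apply/eqP; rewrite eq_le; apply/andP; split.
  apply: ge_ereal_sup => _ [x _ <-]; have [c Cc ->] := theta_attained x.
  apply: le_trans (ereal_sup_ubound (ex_intro2 _ _ c Cc (erefl _))).
  rewrite bE// (rpartK f_proper (C_dom Cc)).
  have [xdom|] := pselect (edom f (x + c)); last first.
    by move=> /negP; rewrite -leNgt leye_eq => /eqP ->; rewrite addye// leNye.
  rewrite rpartK// -!EFinB lee_fin.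
  have := (subdifferentialP f_proper _ ydom).1 uy _ xdom.
  by rewrite !dotpBr dotpDr; lra.
apply: ge_ereal_sup => _ [c Cc <-]; rewrite bE//.
(* At [x = y - c] the subgradient inequality used above is an equality, since [x + c = y]. *)
apply: le_trans (ereal_sup_ubound (ex_intro2 _ _ (y - c) I (erefl _))).
have := theta_le (y - c) Cc; rewrite subrK.
rewrite (rpartK f_proper (C_dom Cc)) (rpartK f_proper ydom).
case: (theta f C (y - c)) (theta_gtNy (y - c)) => [r| |]//.
by rewrite -!EFinB !lee_fin !dotpBr; lra.
Qed.

Lemma theta0 : theta f C 0 = 0%E.
Proof.
by have [c Cc ->] := theta_attained 0; rewrite add0r (rpartK f_proper (C_dom Cc)) subee.
Qed.

(* Both difference quotients dominate those of the convex function [theta],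
   for which [theta (h v) + theta (- h v) >= 2 theta 0 = 0]. *)
Lemma grad_le_of_theta_convex c d v : convex_efun (theta f C) -> C c -> C d ->
  dotp (grad f c) v <= dotp (grad f d) v.
Proof.
move=> theta_convex Cc Cd.
have [Uc Ud] := (C_sub Cc, C_sub Cd).
(* The claim becomes nonnegativity of the derivative at [d] along [v] plus the one at [c] along
   [- v]. *)
rewrite -[leLHS]opprK -dotpNr -!derive_dotp; [|exact: f_diff|exact: f_diff].
have dc := derive_right (@diff_derivable _ _ _ _ _ (- v) (f_diff Uc)).
have dd := derive_right (@diff_derivable _ _ _ _ _ v (f_diff Ud)).
rewrite -subr_ge0 opprK.
have /(_ _) dcd := cvgD dd dc; rewrite -(cvg_lim _ dcd)//.
apply: limr_ge; first by apply/cvg_ex; eexists; exact: dcd.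
near=> h.
have h0 : 0 < h by near: h; exact: nbhs_right_gt.
have cdom : edom f (h *: - v + c) by near: h; exact: (@cvg_line_right _ _ c (- v) _ Uc).
have ddom : edom f (h *: v + d) by near: h; exact: (@cvg_line_right _ _ d v _ Ud).
rewrite fctE -mulrDr mulr_ge0 ?invr_ge0 ?(ltW h0)//.
have h2 : 0 < (2^-1 : R) < 1 by apply/andP; split; lra.
have := theta_convex (h *: v) (h *: - v) 2^-1 h2.
have -> : 2^-1 *: (h *: v) + (1 - 2^-1) *: (h *: - v) = 0 :> E.
  by rewrite !scalerN !scalerA -scalerBl (_ : _ - _ = 0) ?scale0r//; lra.
rewrite theta0.
have := theta_le (h *: v) Cd; have := theta_le (h *: - v) Cc.
rewrite (rpartK f_proper cdom) (rpartK f_proper ddom).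
rewrite (rpartK f_proper (C_dom Cc)) (rpartK f_proper (C_dom Cd)).
case: (theta f C (h *: v)) (theta_gtNy (h *: v)) => [r| |]// _.
case: (theta f C (h *: - v)) (theta_gtNy (h *: - v)) => [s| |]// _.
rewrite -!EFinB -!EFinM -EFinD !lee_fin; lra.
Unshelve. all: by end_near. Qed.

(** Comparing gradients in both orders makes them agree on [C], and a slope determines its point.
    Conversely, for a single [c], [theta] is a translate of [f] minus a constant. *)
Lemma theta_convexP : convex_efun (theta f C) <-> exists c, C = [set c].
Proof.
split=> [theta_convex|[c CE]].
  have [c Cc] := C_nonempty; exists c; apply/seteqP; split=> [d Cd|_ ->//].
  have gcd : grad f d = grad f c.
    by apply: dotp_le_eq => v; exact: grad_le_of_theta_convex.
  apply: (legendre_subdifferential_inj f_legendre (u := grad f c)).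
    by rewrite -gcd; apply: grad_subdifferential => //; exact: C_sub.
  by apply: grad_subdifferential => //; exact: C_sub.
have thetaE x : theta f C x = (f (x + c)%R - f c)%E.
  by have [d + ->] := theta_attained x; rewrite CE => ->.
have /C_dom cdom : C c by rewrite CE.
move=> x y t t01; rewrite !thetaE (rpartK f_proper cdom).
have [t0 t1] : 0 < t /\ 0 < 1 - t by case/andP: t01; rewrite subr_gt0.
(* If one endpoint has value [+oo], the right-hand side is [+oo], because the other term is never
   [-oo]. *)
have [xdom|] := pselect (edom f (x + c)); last first.
  move=> /negP; rewrite -leNgt leye_eq => /eqP ->; rewrite addye// gt0_muley ?lte_fin//.
  rewrite addye ?leey//; have := theta_gtNy y; rewrite thetaE (rpartK f_proper cdom).
  case: (f (y + c)) => [r _| _|]; last by rewrite ltxx.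
    by rewrite -EFinB -EFinM.
  by rewrite addye// gt0_muley ?lte_fin.
have [ydom|] := pselect (edom f (y + c)); last first.
  move=> /negP; rewrite -leNgt leye_eq => /eqP ->; rewrite addye// gt0_muley ?lte_fin//.
  by rewrite (rpartK f_proper xdom) -EFinB -EFinM addey ?leey.
have -> : t *: x + (1 - t) *: y + c = t *: (x + c) + (1 - t) *: (y + c).
  by rewrite !scalerDr addrACA -scalerDl subrKC scale1r.
have mdom := edom_convex f_proper f_convex t01 xdom ydom.
have := rpart_convex f_proper f_convex t01 xdom ydom.
rewrite (rpartK f_proper xdom) (rpartK f_proper ydom) (rpartK f_proper mdom).
by rewrite -!EFinB -!EFinM -EFinD lee_fin; lra.
Qed.

End Theta.

Theorem theorem6p6 (R : realType) (J : nat) (f : 'rV[R]_J -> \bar R)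
    (C : set 'rV[R]_J)
    (f_legendre : convex_legendre f)
    (f_coercive : one_coercive f)
    (C_nonempty : C !=set0)
    (C_bounded : ebounded C)
    (C_closed : closed C)
    (C_sub : C `<=` (edom f)^°) :
  [/\ eproper (theta f C),
      lower_semicontinuous (theta f C),
      theta f C = infconv f (neg_reflection f C)
    & edom (theta f C) = [set u - c | u in edom f & c in C]] /\
  [/\ forall x, edom (theta f C) x -> infconv_exact f (neg_reflection f C) x,
      conjugate (theta f C) = bregman_sup f C \o grad (conjugate f)
    & convex_efun (theta f C) <-> exists c, C = [set c]].
Proof.
have C_compact : compact C.
  exact: bounded_closed_compact (ebounded_bounded C_bounded) C_closed.
split; split.
- split=> [x|]; first exact: theta_gtNy.
  by exists 0; rewrite /edom/= theta0// ltry.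
- exact: theta_lsc.
- exact: theta_infconv.
- exact: edom_theta.
- by move=> x _; exact: theta_infconv_exact.
- apply/funext => u /=.
  have [y uy] := exists_subdifferential f_legendre f_coercive u.
  by rewrite (grad_conjugate f_legendre f_coercive uy); exact: conjugate_theta.
- exact: theta_convexP.
Qed.
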